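(* Let $\mathbb{k}$ be a field of prime characteristic $p$, let $A=\mathbb{k}[x_1]/(x_1^p)$, $B=\mathbb{k}[x_2]/(x_2^p)$, let $\alpha\in\mathbb{k}$ and $2\le t\le p-1$, let $\delta$ be the derivation of $A$ with $\delta(\overline{x_1})=\alpha\overline{x_1}^t$, and let $A\otimes_\tau B=A[\overline{x_2};\mathrm{id}_A,\delta]$ be the truncated Ore extension with twisting map $\tau$ determined by $\tau(\overline{x_2}\otimes a)=a\otimes\overline{x_2}+\delta(a)\otimes1$ for $a \in A$. Regard $\mathbb{k}$ as a left $A\otimes_\tau B$-module via the augmentation $a\otimes b\mapsto\epsilon_A(a)\epsilon_B(b)$, where $\epsilon_A(\overline{x_1})=0$, $\epsilon_B(\overline{x_2})=0$. For $i,j\ge0$ let $Y_{i,j}=A\otimes B$ as a vector space, with left $A\otimes_\tau B$-module structure given by $(m_A\otimes m_B)(1\otimes\tau_{B,i}\otimes1):A\otimes B\otimes A\otimes B\to A\otimes B$, where $\tau_{B,i}$ is as in the context. Put $Y_n=\bigoplus_{i+j=n}Y_{i,j}$ and $d_n=\sum_{i+j=n}(d^h_{i,j}+d^v_{i,j})$, where $d^h_{i,j}:Y_{i,j}\to Y_{i-1,j}$ $(i\geq 1)$ is $(\overline{x_1}\cdot)\otimes1$ for $i$ odd and $(\overline{x_1}^{p-1}\cdot)\otimes1$ for $i$ even, and $d^v_{i,j}:Y_{i,j}\to Y_{i,j-1}$ $(j\ge1)$ is $(-1)^i\otimes(\overline{x_2}\cdot)$ for $j$ odd and $(-1)^i\otimes(\overline{x_2}^{p-1}\cdot)$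 for $j$ even (with $d^h_{0,j}=0$, $d^v_{i,0}=0$). Then $$\cdots\xrightarrow{d_2}Y_1\xrightarrow{d_1}Y_0\xrightarrow{\epsilon_A\otimes\epsilon_B}\mathbb{k}\to0$$ is a projective resolution of $\mathbb{k}$ as a left $A\otimes_\tau B$-module.
   Context: Tensor products are over $\mathbb{k}$. $\overline{x_1},\overline{x_2}$ denote the classes of $x_1,x_2$; $m_A,m_B$ are the multiplication maps. $A\otimes_\tau B$ is the vector space $A\otimes B$ with the associative multiplication $(m_A\otimes m_B)(1\otimes\tau\otimes1)$; equivalently the algebra generated by $\overline{x_1},\overline{x_2}$ with $\overline{x_1}^p=\overline{x_2}^p=0$ and $\overline{x_2}\,\overline{x_1}=\overline{x_1}\,\overline{x_2}+\alpha\overline{x_1}^t$. For $s,j\geq 0$ let $(s)^{[j]}=\prod_{l=0}^{j-1}(s+l(t-1))$, $(s)^{[0]}=1$. For $i\ge0$, $\tau_{B,i}:B\otimes A\to A\otimes B$ is the $\mathbb{k}$-linear map given on basis elements ($0\le r,s\le p-1$) by $$\tau_{B,i}(\overline{x_2}^r\otimes\overline{x_1}^s)=\begin{cases}\sum_{j=0}^r\binom rj(s)^{[j]}\alpha^j\,\overline{x_1}^{s+j(t-1)}\otimes\overline{x_2}^{r-j}& i\text{ even},\\ \sum_{j=0}^r\binom rj(s+1)^{[j]}\alpha^j\,\overline{x_1}^{s+j(t-1)}\otimes\overline{x_2}^{r-j}& i\text{ odd};\end{cases}$$ for $i$ even this is $\tau$ itself. *)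

(* Defs.v *)
From HB Require Import structures.
From mathcomp Require Import all_boot all_order all_algebra.

Set Implicit Arguments.
Unset Strict Implicit.
Unset Printing Implicit Defensive.

Import GRing.Theory VectorInternalTheory.
Local Open Scope ring_scope.

Section Tensor.
Variable k : fieldType.

(* The tensor product over k of finite-dimensional spaces, in coordinates:
   the matrix w stands for the sum of the w i j *: (e_i (x) f_j), where e and f
   are the bases of U and V given by the isomorphisms v2r with row vectors.
   tlift_tens and tensor_ext give the universal property. *)
Definition tensor (U V : vectType k) : Type := 'M[k]_(dim U, dim V).

HB.instance Definition _ (U V : vectType k) :=
  Vector.copy (tensor U V) 'M[k]_(dim U, dim V).

Definition tens (U V : vectType k) (u : U) (v : V) : tensor U V :=
  (v2r u)^T *m v2r v.

Definition tlift (U V : vectType k) (W : lmodType k) (f : U -> V -> W)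
    (w : tensor U V) : W :=
  \sum_i \sum_j
    (w : 'M_(_, _)) i j *: f (r2v (delta_mx 0 i)) (r2v (delta_mx 0 j)).

Definition tmap (U V U' V' : vectType k) (f : U -> U') (g : V -> V') :
    tensor U V -> tensor U' V' :=
  tlift (fun u v => tens (f u) (g v)).

Definition is_bilinear (U V W : lmodType k) (f : U -> V -> W) :=
  (forall v, linear (f^~ v)) /\ (forall u, linear (f u)).

Lemma linear_sumZ (U V : lmodType k) (f : U -> V) : linear f ->
  forall (I : finType) (c : I -> k) (F : I -> U),
  f (\sum_i c i *: F i) = \sum_i c i *: f (F i).
Proof.
move=> lf I c F.
have f0 : f 0 = 0 by have := lf (-1) 0 0; rewrite scaler0 addr0 scaleN1r addNr.
apply: (big_rec2 (fun x y => f x = y)) => [|i x y _ <-]; first exact: f0.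
by rewrite lf.
Qed.

Lemma linear_sum1 (U V : lmodType k) (f : U -> V) : linear f ->
  forall (I : finType) (F : I -> U), f (\sum_i F i) = \sum_i f (F i).
Proof.
move=> lf I F; under eq_bigr do rewrite -[F _]scale1r.
by rewrite (linear_sumZ lf); apply: eq_bigr => i _; rewrite scale1r.
Qed.

Lemma tens_bilinear (U V : vectType k) : is_bilinear (@tens U V).
Proof.
split=> [v c u1 u2|u c v1 v2]; rewrite /tens linearP.
  by rewrite linearP mulmxDl -scalemxAl.
by rewrite mulmxDr -scalemxAr.
Qed.

Lemma tlift_linear (U V : vectType k) (W : lmodType k) (f : U -> V -> W) :
  linear (tlift f).
Proof.
move=> c w1 w2; rewrite /tlift scaler_sumr -big_split /=; apply: eq_bigr => i _.
rewrite scaler_sumr -big_split /=; apply: eq_bigr => j _.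
by rewrite !mxE scalerDl scalerA.
Qed.

HB.instance Definition _ (U V : vectType k) (W : lmodType k) (f : U -> V -> W) :=
  GRing.isLinear.Build k (tensor U V) W _ (tlift f) (tlift_linear f).

HB.instance Definition _ (U V U' V' : vectType k) (f : U -> U') (g : V -> V') :=
  GRing.Linear.copy (tmap f g) (tlift (fun u v => tens (f u) (g v))).

Lemma r2v_sum (U : vectType k) (u : U) :
  u = \sum_i v2r u 0 i *: r2v (delta_mx 0 i).
Proof.
by rewrite -{1}[u]v2rK [in LHS](row_sum_delta (v2r u)) linear_sum;
   apply: eq_bigr => i _; rewrite linearZ.
Qed.

Lemma tlift_tens (U V : vectType k) (W : lmodType k) (f : U -> V -> W) :
  is_bilinear f -> forall u v, tlift f (tens u v) = f u v.
Proof.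
move=> [fl fr] u v; rewrite [in RHS](r2v_sum u) (linear_sumZ (fl v)).
apply: eq_bigr => i _; rewrite [in RHS](r2v_sum v) (linear_sumZ (fr _)).
rewrite scaler_sumr; apply: eq_bigr => j _.
by rewrite scalerA /tens !mxE big_ord1 !mxE.
Qed.

Lemma tensor_sum (U V : vectType k) (w : tensor U V) :
  w = tlift (@tens U V) w.
Proof.
rewrite /tlift [LHS]matrix_sum_delta; apply: eq_bigr => i _.
apply: eq_bigr => j _; congr (_ *: _).
by rewrite /tens !r2vK trmx_delta mul_delta_mx.
Qed.

Lemma tensor_ext (U V : vectType k) (W : lmodType k)
    (f g : tensor U V -> W) : linear f -> linear g ->
  (forall u v, f (tens u v) = g (tens u v)) -> f =1 g.
Proof.
move=> lf lg fg w; rewrite (tensor_sum w) /tlift.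
rewrite (linear_sum1 lf) (linear_sum1 lg); apply: eq_bigr => i _.
rewrite (linear_sumZ lf) (linear_sumZ lg).
by apply: eq_bigr => j _; rewrite fg.
Qed.

Lemma tlift_comb (U V : vectType k) (W : lmodType k) (f g h : U -> V -> W) c :
  (forall u v, f u v = c *: g u v + h u v) ->
  forall w, tlift f w = c *: tlift g w + tlift h w.
Proof.
move=> fgh w; rewrite /tlift scaler_sumr -big_split /=; apply: eq_bigr => i _.
rewrite scaler_sumr -big_split /=; apply: eq_bigr => j _.
by rewrite fgh scalerDr !scalerA mulrC.
Qed.

Lemma tmap_tens (U V U' V' : vectType k) (f : {linear U -> U'})
    (g : {linear V -> V'}) u v : tmap f g (tens u v) = tens (f u) (g v).
Proof.
rewrite /tmap tlift_tens //; have [tl tr] := tens_bilinear U' V'.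
by split=> [w c w1 w2|w c w1 w2]; rewrite linearP ?tl ?tr.
Qed.

End Tensor.

Section TwistedTensor.
Variables (k : fieldType) (p : nat).

Definition trunc : Type := {poly %/ ('X^p : {poly k})}.
HB.instance Definition _ := Vector.copy trunc {poly %/ ('X^p : {poly k})}.
HB.instance Definition _ :=
  GRing.ComAlgebra.copy trunc {poly %/ ('X^p : {poly k})}.

Local Notation A := trunc.
Local Notation B := trunc.

Definition tx : trunc := 'qX.
Local Notation x1 := (tx : A).
Local Notation x2 := (tx : B).

Definition tcoef (s : nat) (a : trunc) : k := (a : {poly k})`_s.

(* eps_A and eps_B, as evaluation at 0 of a representative *)
Definition taug (a : trunc) : k := (a : {poly k}).[0].

(* eps_A (x) eps_B *)
Definition eps (w : tensor A B) : k :=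
  tlift (fun (a : A) (b : B) => taug a * taug b : k^o) w.

Variables (t : nat) (alpha : k).

(* rfact s j is the natural number (s)^{[j]}. *)
Definition rfact (s j : nat) : nat := \prod_(l < j) (s + l * t.-1)%N.

(* delta, the derivation of A with delta(x1) = alpha x1^t. *)
Definition der (a : A) : A := in_qpoly 'X^p (alpha *: 'X^t * (a : {poly k})^`()).

(* The value of tau_{B,i} on the basis vector x2^r (x) x1^s; the boolean odd i
   is coerced to 0 or 1, so that s + odd i is s for i even, s + 1 for i odd. *)
Definition tauB_basis (i r s : nat) : tensor A B :=
  \sum_(j < r.+1) (('C(r, j) * rfact (s + odd i) j)%:R * alpha ^+ j) *:
    tens (x1 ^+ (s + j * t.-1)) (x2 ^+ (r - j)).

Definition tauB (i : nat) : tensor B A -> tensor A B :=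
  tlift (fun b a => \sum_(r < p) \sum_(s < p)
    (tcoef r b * tcoef s a) *: tauB_basis i r s).

Definition tau : tensor B A -> tensor A B := tauB 0.

(* (m_A (x) m_B)(1 (x) sigma (x) 1) : A (x) B (x) A (x) B -> A (x) B, as a
   function of two arguments in A (x) B; on (a (x) b, a' (x) b') it is the image
   of sigma(b (x) a') under c (x) d |-> a c (x) d b'. *)
Definition twist_mul (sigma : tensor B A -> tensor A B) (w w' : tensor A B) :
    tensor A B :=
  tlift (fun (a : A) (b : B) =>
    tlift (fun (a' : A) (b' : B) =>
      tmap (fun c : A => a * c) (fun d : B => d * b') (sigma (tens b a'))) w') w.

Hypotheses (charkp : p \in [pchar k]) (t_bnd : (2 <= t <= p.-1)%N).

Let p_gt0 : (0 < p)%N. Proof. exact: prime_gt0 (pcharf_prime charkp). Qed.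

Let mkmonicXp : mk_monic 'X^p = 'X^p :> {poly k}.
Proof. by rewrite mk_monic_Xn prednK. Qed.

Let size_mkm : size (mk_monic 'X^p : {poly k}) = p.+1.
Proof. by rewrite mkmonicXp size_polyXn. Qed.

Let txE s : tx ^+ s = in_qpoly 'X^p 'X^s.
Proof. by rewrite /tx /qpolyX -rmorphXn. Qed.

Let tx_ge s : (p <= s)%N -> tx ^+ s = 0.
Proof.
move=> ps; rewrite -(subnK ps) exprD [tx ^+ p]txE.
suff -> : in_qpoly 'X^p ('X^p : {poly k}) = 0 by rewrite mulr0.
by apply: val_inj; rewrite /= mkmonicXp Pdiv.RingMonic.rmodpp ?monicXn.
Qed.

Let val_tx s : (s < p)%N -> tx ^+ s = 'X^s :> {poly k}.
Proof. by move=> sp; rewrite txE in_qpoly_small // size_polyXn size_mkm. Qed.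

Let tcoef_linear s : linear (tcoef s : trunc -> k^o).
Proof. by move=> c a b; rewrite /tcoef /= coefD coefZ. Qed.

Let tcoef_tx r s : (s < p)%N -> tcoef r (tx ^+ s) = (r == s)%:R.
Proof. by move=> sp; rewrite /tcoef val_tx // coefXn. Qed.

Let trunc_sum (a : trunc) : a = \sum_(s < p) tcoef s a *: tx ^+ s.
Proof.
apply/npolyP => i; rewrite -[RHS]/(tcoef i _) (linear_sumZ (tcoef_linear i)).
rewrite -[LHS]/(tcoef i a); under eq_bigr => s _ do rewrite tcoef_tx //.
have [ip|pi] := ltnP i p; last first.
  rewrite /tcoef big_coef_npoly ?size_mkm // big1 // => s _.
  rewrite [_ == _]gtn_eqF ?scaler0 //; exact: leq_trans pi.
rewrite (bigD1 (Ordinal ip)) //= eqxx big1 ?addr0 => [|s].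
  by rewrite /GRing.scale /= mulr1.
by rewrite -val_eqE /= eq_sym => /negPf ->; rewrite scaler0.
Qed.

Lemma trunc_ext (W : lmodType k) (f g : trunc -> W) : linear f -> linear g ->
  (forall s, (s < p)%N -> f (tx ^+ s) = g (tx ^+ s)) -> f =1 g.
Proof.
move=> lf lg fg a; rewrite (trunc_sum a) (linear_sumZ lf) (linear_sumZ lg).
by apply: eq_bigr => s _; rewrite fg.
Qed.

Local Notation mon a b := (tens (tx ^+ a : A) (tx ^+ b : B)).

Lemma mon_ext (W : lmodType k) (f g : tensor trunc trunc -> W) :
  linear f -> linear g ->
  (forall a b, (a < p)%N -> (b < p)%N -> f (mon a b) = g (mon a b)) -> f =1 g.
Proof.
move=> lf lg fg; apply: tensor_ext => // u v.
have [tl tr] := @tens_bilinear k trunc trunc.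
apply: (@trunc_ext _ (fun u => f (tens u v)) (fun u => g (tens u v)))
  => [c u1 u2|c u1 u2|a ap].
- by rewrite tl lf.
- by rewrite tl lg.
apply: (@trunc_ext _ (fun v => f (tens _ v)) (fun v => g (tens _ v)))
  => [c u1 u2|c u1 u2|b bp].
- by rewrite tr lf.
- by rewrite tr lg.
exact: fg.
Qed.

Let mon_gel a b : (p <= a)%N -> mon a b = 0.
Proof.
by move=> pa; rewrite tx_ge // /tens linear0 trmx0 mul0mx.
Qed.

Let mon_ger a b : (p <= b)%N -> mon a b = 0.
Proof. by move=> pa; rewrite [tx ^+ b]tx_ge // /tens linear0 mulmx0. Qed.

Lemma tauB_tens_bilinear i :
  is_bilinear (fun (b : B) (a : A) => \sum_(r < p) \sum_(s < p)
    (tcoef r b * tcoef s a) *: tauB_basis i r s).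
Proof.
split=> [v c u1 u2|u c v1 v2]; rewrite scaler_sumr -big_split /=;
  apply: eq_bigr => r _; rewrite scaler_sumr -big_split /=;
  apply: eq_bigr => s _; rewrite (tcoef_linear _ c) scalerA -scalerDl;
  congr (_ *: _).
- by rewrite mulrDl -!mulrA.
- by rewrite mulrDr mulrCA.
Qed.

Lemma tauB_tens i r s : (r < p)%N -> (s < p)%N ->
  tauB i (tens (tx ^+ r) (tx ^+ s)) = tauB_basis i r s.
Proof.
move=> rp sp; rewrite /tauB tlift_tens; last exact: tauB_tens_bilinear.
rewrite (bigD1 (Ordinal rp)) //= [X in _ + X]big1 ?addr0; last first.
  move=> r' nr; rewrite big1 // => s' _; rewrite tcoef_tx //.
  by rewrite -val_eqE /= in nr; rewrite (negPf nr) mul0r scale0r.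
rewrite (bigD1 (Ordinal sp)) //= big1 ?addr0; last first.
  move=> s' ns; rewrite [tcoef s' _]tcoef_tx //.
  by rewrite -val_eqE /= in ns; rewrite (negPf ns) mulr0 scale0r.
by rewrite !tcoef_tx // !eqxx mulr1 scale1r.
Qed.

HB.instance Definition _ i := GRing.Linear.copy (tauB i)
  (tlift (fun b a => \sum_(r < p) \sum_(s < p)
    (tcoef r b * tcoef s a) *: tauB_basis i r s)).
HB.instance Definition _ := GRing.Linear.copy tau (tauB 0).

Let tensl (c : k) (u u' v : trunc) :
  tens (c *: u + u') v = c *: tens u v + tens u' v.
Proof. exact: (@tens_bilinear k trunc trunc).1. Qed.

Let tensr (c : k) (u v v' : trunc) :
  tens u (c *: v + v') = c *: tens u v + tens u v'.
Proof. exact: (@tens_bilinear k trunc trunc).2. Qed.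

Let tmapM_tens (a b c d : trunc) :
  tmap (fun u : A => a * u) (fun v : B => v * b) (tens c d) =
  tens (a * c) (d * b).
Proof.
rewrite /tmap tlift_tens //; split=> [w e w1 w2|w e w1 w2].
  by rewrite mulrDr -scalerAr tensl.
by rewrite mulrDl -scalerAl tensr.
Qed.

Let twist_arg (sigma : {linear tensor B A -> tensor A B}) (a : A) (b : B) :
  is_bilinear (fun (a' : A) (b' : B) =>
    tmap (fun c : A => a * c) (fun d : B => d * b') (sigma (tens b a'))).
Proof.
split=> [b' e u u'|a' e v v']; first by rewrite tensr !linearP.
by apply: tlift_comb => u w; rewrite mulrDr -scalerAr tensr.
Qed.

Let twist_argl (sigma : {linear tensor B A -> tensor A B}) w' :
  is_bilinear (fun (a : A) (b : B) =>
    tlift (fun (a' : A) (b' : B) =>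
      tmap (fun c : A => a * c) (fun d : B => d * b') (sigma (tens b a'))) w').
Proof.
split=> [b e u u'|a e v v']; apply: tlift_comb => a' b'.
  by apply: tlift_comb => c d; rewrite mulrDl -scalerAl tensl.
by rewrite tensl !linearP.
Qed.

Let twist_tens (sigma : {linear tensor B A -> tensor A B}) a b w' :
  twist_mul sigma (tens a b) w' =
    tlift (fun (a' : A) (b' : B) =>
      tmap (fun c : A => a * c) (fun d : B => d * b') (sigma (tens b a'))) w'.
Proof. by rewrite /twist_mul tlift_tens //; exact: twist_argl. Qed.

Lemma twist_mul_tens (sigma : {linear tensor B A -> tensor A B}) a b a' b' :
  twist_mul sigma (tens a b) (tens a' b') =
    tmap (fun c : A => a * c) (fun d : B => d * b') (sigma (tens b a')).
Proof. by rewrite twist_tens tlift_tens //; exact: twist_arg. Qed.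

Lemma twist_mul_linearl (sigma : {linear tensor B A -> tensor A B}) w' :
  linear (fun w => twist_mul sigma w w').
Proof. by move=> c w1 w2; rewrite /twist_mul linearP. Qed.

Lemma twist_mul_linearr (sigma : {linear tensor B A -> tensor A B}) w :
  linear (twist_mul sigma w).
Proof.
move=> c w1 w2; move: w; apply: tensor_ext; try exact: twist_mul_linearl.
  move=> e u v; rewrite !(twist_mul_linearl sigma _ e) !scalerDr !scalerA.
  by rewrite ![c * e]mulrC addrACA.
by move=> u v; rewrite !twist_tens linearP.
Qed.

Local Notation rho i := (twist_mul (tauB i)).
Let tp := t.-1.

Let mulL (a : A) : tensor A B -> tensor A B := tmap (fun c : A => a * c) idfun.

Let mulL_linear a : linear (mulL a).
Proof. by move=> c u v; rewrite /mulL linearP. Qed.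

Let mulL_tens a c d : mulL a (tens c d) = tens (a * c) d.
Proof.
rewrite /mulL /tmap tlift_tens //; split=> [w e w1 w2|w e w1 w2] /=.
  by rewrite mulrDr -scalerAr tensl.
by rewrite tensr.
Qed.

Let rho_tens i (a : A) (b : B) w :
  rho i (tens a b) w = mulL a (rho i (tens (1 : A) b) w).
Proof.
move: w; apply: tensor_ext => [||a' b']; try exact: twist_mul_linearr.
  by move=> c u v; rewrite twist_mul_linearr mulL_linear.
rewrite !twist_mul_tens /=; move: (tauB i _).
apply: tensor_ext => [c u v|c u v|u v].
- by rewrite linearP.
- by rewrite linearP mulL_linear.
by rewrite !tmapM_tens mulL_tens mul1r.
Qed.

Let Z i := rho i (tens (1 : A) tx).

Let Z_linear i : linear (Z i). Proof. exact: twist_mul_linearr. Qed.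

Let rho_formula i b c d : (b < p)%N ->
  rho i (mon 0 b) (mon c d) =
  \sum_(j < b.+1) (('C(b, j) * rfact (c + odd i) j)%:R * alpha ^+ j) *:
    mon (c + j * tp) (b - j + d).
Proof.
move=> bp; have [cp|pc] := ltnP c p; last first.
  rewrite (mon_gel _ pc) (_ : rho i _ 0 = 0).
    by rewrite big1 // => j _; rewrite mon_gel ?scaler0 ?(leq_trans pc) ?leq_addr.
  have := twist_mul_linearr (tauB i) (mon 0 b) (-1) 0 0.
  by rewrite scaler0 addr0 scaleN1r addNr.
rewrite twist_mul_tens /= tauB_tens // linear_sum; apply: eq_bigr => j _.
by rewrite linearZ /= tmapM_tens expr0 mul1r -exprD.
Qed.

Let Zmon i c d : Z i (mon c d) =
  mon c d.+1 + ((c + odd i)%:R * alpha) *: mon (c + tp) d.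
Proof.
have p1 : (1 < p)%N by apply: prime_gt1 (pcharf_prime charkp).
have := @rho_formula i 1 c d p1; rewrite expr0 expr1 /Z => ->.
rewrite big_ord_recl big_ord1 /= /rfact big_ord0 big_ord1 !mul0n !addn0 !mul1n.
by rewrite !mul1r scale1r.
Qed.

Let rfactS s j : rfact s j.+1 = (s * rfact (s + tp) j)%N.
Proof.
rewrite /rfact big_ord_recl /= mul0n addn0; congr (_ * _)%N.
by apply: eq_bigr => l _; rewrite /bump /= add1n mulSn addnA.
Qed.

Let Ziter i b c d : iter b (Z i) (mon c d) =
  \sum_(j < b.+1) (('C(b, j) * rfact (c + odd i) j)%:R * alpha ^+ j) *:
    mon (c + j * tp) (b - j + d).
Proof.
have Zl n : linear (iter n (Z i)).
  by elim: n => [|n IH] c' u v //=; rewrite IH Z_linear.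
elim: b c d => [|b IH] c d.
  by rewrite big_ord1 /rfact big_ord0 /= expr0 mul0n addn0 subn0 mulr1 scale1r.
rewrite iterSr Zmon addrC Zl !IH [RHS]big_ord_recl /=.
under [in RHS]eq_bigr => j _.
  rewrite /bump /= add1n binS mulnDl natrD mulrDl scalerDl.
  over.
rewrite big_split /= [RHS]addrA [RHS]addrC; congr (_ + _).
  rewrite scaler_sumr; apply: eq_bigr => j _; rewrite subSS scalerA rfactS.
  rewrite -addnA [(tp + odd i)%N]addnC addnA mulSn addnA; congr (_ *: _).
  by rewrite exprS !natrM mulrACA; congr (_ * _); rewrite mulrCA.
rewrite big_ord_recl /= [in RHS]big_ord_recr /= (@bin_small b b.+1) //.
rewrite mul0n mul0r scale0r addr0.
rewrite !bin0 !subn0 addSnnS; congr (_ + _); apply: eq_bigr => j _.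
rewrite /bump /= add1n; congr (_ *: mon _ _).
by rewrite subSS addnS -addSn -subSn // subSS.
Qed.

Let Ziter_linear i b : linear (iter b (Z i)).
Proof. by elim: b => [|b IH] c' u v //=; rewrite IH Z_linear. Qed.

Let Ziter_p i w : iter p (Z i) w = 0.
Proof.
have t2 : (0 < tp)%N by rewrite /tp; case/andP: t_bnd; case: (t) => [|[]].
move: w; apply: mon_ext => [|c u v|c d _ _]; first exact: Ziter_linear.
  by rewrite scaler0 addr0.
rewrite Ziter big1 // => j _.
have [->|j0] := eqVneq (j : nat) 0%N.
  by rewrite mon_ger ?scaler0 // subn0 leq_addr.
have [->|jp] := eqVneq (j : nat) p.
  rewrite mon_gel ?scaler0 // (leq_trans _ (leq_addl _ _)) //.
  by rewrite leq_pmulr.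
have /dvdnP[q ->] : (p %| 'C(p, j))%N.
  apply: prime_dvd_bin; first exact: pcharf_prime charkp.
  by rewrite lt0n j0 /= ltn_neqAle jp -ltnS ltn_ord.
by rewrite !natrM (pcharf0 charkp) mulr0 !mul0r scale0r.
Qed.

Let rho_mon i a b w : rho i (mon a b) w = mulL (tx ^+ a) (iter b (Z i) w).
Proof.
have [bp|pb] := ltnP b p; last first.
  rewrite (mon_ger _ pb) -(subnK pb) iterD Ziter_p.
  have l0 (f : tensor A B -> tensor A B) : linear f -> f 0 = 0.
    by move=> lf; have := lf (-1) 0 0; rewrite scaler0 addr0 scaleN1r addNr.
  by rewrite (l0 _ (Ziter_linear _ _)) (l0 _ (mulL_linear _))
             (l0 _ (@twist_mul_linearl (tauB i) _)).
rewrite rho_tens; congr (mulL _ _).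
move: w; apply: mon_ext => [||c d cp dp]; first exact: twist_mul_linearr.
  exact: Ziter_linear.
by rewrite Ziter -(rho_formula _ _ _ bp) expr0.
Qed.

Let mulLM a b w : mulL a (mulL b w) = mulL (a * b) w.
Proof.
move: w; apply: tensor_ext => [c u v|c u v|u v].
- by rewrite !mulL_linear.
- by rewrite !mulL_linear.
by rewrite !mulL_tens mulrA.
Qed.

Let mulL1 w : mulL 1 w = w.
Proof.
by move: w; apply: tensor_ext => [c u v|c u v|u v];
  rewrite ?mulL_linear ?mulL_tens ?mul1r.
Qed.

Let Z_mulL i a w : Z i (mulL (tx ^+ a) w) =
  mulL (tx ^+ a) (Z i w) + (a%:R * alpha) *: mulL (tx ^+ (a + tp)) w.
Proof.
move: w; apply: mon_ext => [e u v|e u v|c d cp dp].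
- by rewrite mulL_linear Z_linear.
- rewrite Z_linear !mulL_linear !scalerDr !scalerA ![e * _]mulrC.
  by rewrite addrACA.
rewrite mulL_tens -exprD !Zmon [mon c d.+1 + _]addrC mulL_linear !mulL_tens.
rewrite -!exprD -addnA natrD mulrDl scalerDl -!addnA [(tp + c)%N]addnC.
by rewrite [RHS]addrAC [RHS]addrC [X in _ + X = _]addrC.
Qed.

Let rho_mulL i a v w : rho i (mulL (tx ^+ a) v) w = mulL (tx ^+ a) (rho i v w).
Proof.
move: v; apply: mon_ext => [e u v|e u v|c d cp dp].
- by rewrite mulL_linear twist_mul_linearl.
- by rewrite twist_mul_linearl mulL_linear.
by rewrite mulL_tens -exprD !rho_mon mulLM exprD.
Qed.

Let rho_Z i v w : rho i (Z 0 v) w = Z i (rho i v w).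
Proof.
move: v; apply: mon_ext => [e u v|e u v|c d cp dp].
- by rewrite Z_linear twist_mul_linearl.
- by rewrite twist_mul_linearl Z_linear.
rewrite Zmon addrC twist_mul_linearl !rho_mon /= Z_mulL addn0 addrC.
by [].
Qed.

(* each tau_{B,i} gives a left action of the algebra A (x)_tau B *)
Lemma twist_act_assoc i u v w : rho i (twist_mul tau u v) w = rho i u (rho i v w).
Proof.
move: u; apply: mon_ext => [e u u'|e u u'|a b ap bp].
- by rewrite !twist_mul_linearl.
- by rewrite !twist_mul_linearl.
rewrite /tau !rho_mon rho_mulL; congr (mulL _ _).
by elim: b {bp} => //= b IH; rewrite rho_Z IH.
Qed.

Lemma twist_act1 i w : rho i (tens (1 : A) (1 : B)) w = w.
Proof. by have := rho_mon i 0 0 w; rewrite !expr0 /= mulL1. Qed.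

Lemma twist_mulr1 w : twist_mul tau w (tens (1 : A) (1 : B)) = w.
Proof.
move: w; apply: mon_ext => [e u u'|e u u'|a b ap bp] //.
  exact: twist_mul_linearl.
rewrite /tau rho_mon (_ : iter b _ _ = mon 0 b) ?mulL_tens -?exprD ?addn0 //.
elim: b {bp} => [|b IH]; first by rewrite !expr0.
by rewrite iterS IH Zmon mul0r scale0r addr0.
Qed.

Lemma taug_tx s : taug (tx ^+ s : trunc) = (s == 0)%:R.
Proof.
have p1 : (1 < p)%N by apply: prime_gt1 (pcharf_prime charkp).
rewrite /taug; have [sp|ps] := ltnP s p; first by rewrite val_tx // hornerXn expr0n.
rewrite tx_ge // horner0; case: s ps => // ; by rewrite leqNgt p_gt0.
Qed.

Lemma eps_tens a b : eps (tens a b) = taug a * taug b.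
Proof.
rewrite /eps tlift_tens //; split=> [v c u1 u2|u c v1 v2]; rewrite /taug /=.
  by rewrite hornerD hornerZ mulrDl /GRing.scale /= mulrA.
by rewrite hornerD hornerZ mulrDr /GRing.scale /= mulrCA.
Qed.

Lemma eps_linear : linear (eps : tensor A B -> k^o).
Proof. by move=> c u v; rewrite /eps linearP. Qed.

Lemma eps_twist_mul u v : eps (twist_mul tau u v) = eps u * eps v.
Proof.
have eL a w : eps (mulL (tx ^+ a) w) = (a == 0)%:R * eps w.
  move: w; apply: (@mon_ext k^o) => [e w w'|e w w'|c d _ _].
  - by rewrite mulL_linear eps_linear.
  - by rewrite eps_linear mulrDr /GRing.scale /= mulrCA.
  rewrite mulL_tens !eps_tens -exprD !taug_tx addn_eq0 mulrA.
  by rewrite -mulnb natrM.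
have eZ w : eps (Z 0 w) = 0.
  move: w; apply: (@mon_ext k^o) => [e w w'|e w w'|c d _ _].
  - by rewrite Z_linear eps_linear.
  - by rewrite scaler0 addr0.
  have t2 : (0 < tp)%N by rewrite /tp; case/andP: t_bnd; case: (t) => [|[]].
  rewrite Zmon addrC eps_linear !eps_tens !taug_tx mulr0 addr0.
  by rewrite addn_eq0 -[tp == 0]negbK -lt0n t2 andbF mul0r scaler0.
move: u; apply: (@mon_ext k^o) => [e u u'|e u u'|a b _ _].
- by rewrite twist_mul_linearl eps_linear.
- by rewrite eps_linear mulrDl /GRing.scale /= mulrA.
rewrite /tau rho_mon eL eps_tens !taug_tx -mulrA; congr (_ * _).
by case: b => [|b]; rewrite ?mul1r //= eZ mul0r.
Qed.

Lemma eps1 : eps (tens (1 : A) (1 : B)) = 1.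
Proof. by have := eps_tens (tx ^+ 0) (tx ^+ 0); rewrite !taug_tx !expr0 mulr1. Qed.

(* der is the derivation of A with value alpha x1^t at x1, and tau is determined
   by it as in a truncated Ore extension. *)
Lemma der_linear : linear der.
Proof.
move=> c u v; rewrite /der /= derivD derivZ mulrDr linearD /=.
by rewrite -scalerAr linearZ.
Qed.

Let der_txn s : der (tx ^+ s) = (s%:R * alpha) *: tx ^+ (s + tp).
Proof.
have [sp|ps] := ltnP s p; last first.
  rewrite tx_ge // [tx ^+ (s + tp)]tx_ge ?scaler0; last first.
    by rewrite (leq_trans ps) ?leq_addr.
  by have := der_linear (-1) 0 0; rewrite scaler0 addr0 scaleN1r addNr.
rewrite /der val_tx // derivXn -scalerAl linearZ /= mulrnAr linearMn /=.
case: s sp => [|s] sp; first by rewrite mulr0n scaler0 mul0r scale0r.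
rewrite -exprD -txE mulrC -scalerA scaler_nat; congr (_ *: (tx ^+ _ *+ _)).
by rewrite /tp; case: (t) t_bnd => // t' _; rewrite addSnnS addnC.
Qed.

Lemma der_tx : der tx = alpha *: tx ^+ t.
Proof.
have := der_txn 1; rewrite expr1 mul1r => ->; congr (_ *: tx ^+ _).
by rewrite /tp; case: (t) t_bnd.
Qed.

Lemma derM a b : der (a * b) = der a * b + a * der b.
Proof.
move: a; apply: trunc_ext => [e u v|e u v|r rp].
- by rewrite mulrDl -scalerAl der_linear.
- rewrite der_linear !mulrDl -!scalerAl scalerDr addrACA; congr (_ + _).
move: b; apply: trunc_ext => [e u v|e u v|s sp].
- by rewrite mulrDr -scalerAr der_linear.
- by rewrite der_linear !mulrDr -!scalerAr scalerDr addrACA.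
rewrite -exprD !der_txn -scalerAl -scalerAr -!exprD natrD mulrDl scalerDl.
by rewrite [(r + tp + s)%N]addnAC addnA.
Qed.

Lemma tau_tx (a : A) :
  tau (tens tx a) = tens a tx + tens (der a) (1 : B).
Proof.
move: a; apply: trunc_ext => [e u v|e u v|s sp].
- by rewrite /tau tensr linearP.
- by rewrite der_linear !tensl scalerDr addrACA.
have p1 : (1 < p)%N by apply: prime_gt1 (pcharf_prime charkp).
rewrite der_txn -[tx in LHS]expr1 /tau tauB_tens //.
rewrite /tauB_basis big_ord_recl big_ord1 /= /rfact big_ord0 big_ord1.
rewrite !mul0n !addn0 !mul1n mul1r scale1r expr1 /=.
rewrite -[X in _ + tens X _]addr0 tensl.
rewrite (_ : tens 0 _ = 0) ?addr0 //.
by have := tensl (-1) 0 0 (1 : B); rewrite scaler0 addr0 scaleN1r addNr.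
Qed.

(* x2 x1 = x1 x2 + alpha x1^t in A (x)_tau B *)
Lemma twist_mul_tx :
  twist_mul tau (tens (1 : A) x2) (tens x1 (1 : B)) =
    twist_mul tau (tens x1 (1 : B)) (tens (1 : A) x2) +
    alpha *: tens (x1 ^+ t) (1 : B).
Proof.
have := Zmon 0 1 0; rewrite /Z !(expr0, expr1) mul1r /tau => ->.
have := rho_mon 0 1 0 (tens (1 : A) x2); rewrite !(expr0, expr1) => ->.
rewrite mulL_tens mulr1 /tp; congr (_ + _ *: @tens k trunc trunc (_ ^+ _) _).
by case: (t) t_bnd.
Qed.

End TwistedTensor.

Section DirectSum.
Variables (R : nzRingType) (I : finType) (M : I -> lmodType R).

Definition dsum : Type := {dffun forall i, M i}.
HB.instance Definition _ := Choice.copy dsum {dffun forall i, M i}.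

Implicit Types u v w : dsum.

Definition dsum_zero : dsum := [ffun i => 0 : M i].
Definition dsum_opp u : dsum := [ffun i => - u i].
Definition dsum_add u v : dsum := [ffun i => u i + v i].
Definition dsum_scale (r : R) u : dsum := [ffun i => r *: u i].

Fact dsum_addA : associative dsum_add.
Proof. by move=> u v w; apply/ffunP => i; rewrite !ffunE addrA. Qed.
Fact dsum_addC : commutative dsum_add.
Proof. by move=> u v; apply/ffunP => i; rewrite !ffunE addrC. Qed.
Fact dsum_add0 : left_id dsum_zero dsum_add.
Proof. by move=> u; apply/ffunP => i; rewrite !ffunE add0r. Qed.
Fact dsum_addN : left_inverse dsum_zero dsum_opp dsum_add.
Proof. by move=> u; apply/ffunP => i; rewrite !ffunE addNr. Qed.

HB.instance Definition _ :=
  GRing.isZmodule.Build dsum dsum_addA dsum_addC dsum_add0 dsum_addN.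

Fact dsum_scaleA r s u : dsum_scale r (dsum_scale s u) = dsum_scale (r * s) u.
Proof. by apply/ffunP => i; rewrite !ffunE scalerA. Qed.
Fact dsum_scale1 : left_id 1 dsum_scale.
Proof. by move=> u; apply/ffunP => i; rewrite !ffunE scale1r. Qed.
Fact dsum_scaleDr : right_distributive dsum_scale +%R.
Proof. by move=> r u v; apply/ffunP => i; rewrite !ffunE scalerDr. Qed.
Fact dsum_scaleDl u : {morph dsum_scale^~ u : r s / r + s}.
Proof. by move=> r s; apply/ffunP => i; rewrite !ffunE scalerDl. Qed.

HB.instance Definition _ := GRing.Zmodule_isLmodule.Build R dsum
  dsum_scaleA dsum_scale1 dsum_scaleDr dsum_scaleDl.

End DirectSum.

Section Resolution.
Variable R : nzRingType.

Definition surjective_fun (U V : Type) (f : U -> V) := forall y, exists x, f x = y.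

Definition projective (P : lmodType R) :=
  forall (M N : lmodType R) (g : {linear M -> N}) (f : {linear P -> N}),
    surjective_fun g -> exists h : {linear P -> M}, forall x, g (h x) = f x.

(* ... -> P 1 -> P 0 -> N -> 0, with d n : P n.+1 -> P n, is a projective
   resolution of the left R-module N. *)
Definition projective_resolution (N : lmodType R) (P : nat -> lmodType R)
    (d : forall n, P n.+1 -> P n) (e : P 0 -> N) :=
  [/\ forall n, projective (P n),
      (forall n, linear (d n)) /\ linear e,
      surjective_fun e,
      forall y, e y = 0 <-> exists x, d 0 x = y
    & forall n y, d n y = 0 <-> exists x, d n.+1 x = y].

End Resolution.

(* The k-algebra A (x)_tau B. The arguments charkp and t_bnd are not used by the
   carrier; they are what makes the product associative. *)
Definition ttensor (k : fieldType) (p : nat) (charkp : p \in [pchar k]) (t : nat)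
    (t_bnd : (2 <= t <= p.-1)%N) (alpha : k) : Type :=
  tensor (trunc k p) (trunc k p).

(* The module Y_{i,j}; j does not affect the action. *)
Definition Ymod (k : fieldType) (p : nat) (charkp : p \in [pchar k]) (t : nat)
    (t_bnd : (2 <= t <= p.-1)%N) (alpha : k) (i j : nat) : Type :=
  tensor (trunc k p) (trunc k p).

(* k as a module over A (x)_tau B, via the augmentation. *)
Definition trivmod (k : fieldType) (p : nat) (charkp : p \in [pchar k]) (t : nat)
    (t_bnd : (2 <= t <= p.-1)%N) (alpha : k) : Type := k.

Section Modules.
Variables (k : fieldType) (p : nat) (charkp : p \in [pchar k]).
Variables (t : nat) (t_bnd : (2 <= t <= p.-1)%N) (alpha : k).

Local Notation A := (trunc k p).
Local Notation B := (trunc k p).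
Local Notation AB := (ttensor charkp t_bnd alpha).

HB.instance Definition _ := GRing.Lmodule.copy AB (tensor A B).

Definition tt_mul : AB -> AB -> AB := twist_mul (tau t alpha).
Definition tt_one : AB := tens (1 : A) (1 : B).

Fact tt_mulA : associative tt_mul.
Proof.
move=> u v w; exact: esym (twist_act_assoc alpha charkp t_bnd 0 u v w).
Qed.
Fact tt_mul1l : left_id tt_one tt_mul.
Proof. exact: (twist_act1 alpha charkp t_bnd 0). Qed.
Fact tt_mul1r : right_id tt_one tt_mul.
Proof. exact: (twist_mulr1 alpha charkp t_bnd). Qed.
Fact tt_mulDl : left_distributive tt_mul +%R.
Proof.
move=> u v w; rewrite -[u]scale1r [LHS]twist_mul_linearl.
by rewrite !scale1r.
Qed.
Fact tt_mulDr : right_distributive tt_mul +%R.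
Proof.
move=> w u v; rewrite -[u]scale1r [LHS]twist_mul_linearr.
by rewrite !scale1r.
Qed.
Fact tt_one_neq0 : tt_one != 0.
Proof.
apply/eqP => e0; have := eps1 charkp; rewrite [tens _ _]e0 /eps linear0.
by move/eqP; rewrite eq_sym oner_eq0.
Qed.

HB.instance Definition _ := GRing.Zmodule_isNzRing.Build AB
  tt_mulA tt_mul1l tt_mul1r tt_mulDl tt_mulDr tt_one_neq0.

Fact tt_scaleAl (c : k) (u v : AB) : c *: (u * v) = c *: u * v.
Proof.
have l0 : 0 * v = 0 by rewrite mul0r.
rewrite -[c *: u]addr0 [RHS]twist_mul_linearl [X in _ + X]l0.
by rewrite [RHS]addr0.
Qed.

HB.instance Definition _ := GRing.Lmodule_isLalgebra.Build k AB tt_scaleAl.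

Fact tt_scaleAr (c : k) (u v : AB) : c *: (u * v) = u * (c *: v).
Proof.
have l0 : u * 0 = 0 by rewrite mulr0.
rewrite -[c *: v]addr0 [RHS]twist_mul_linearr [X in _ + X]l0.
by rewrite [RHS]addr0.
Qed.

HB.instance Definition _ := GRing.Lalgebra_isAlgebra.Build k AB tt_scaleAr.

Section Y.
Variables i j : nat.
Local Notation Y := (Ymod charkp t_bnd alpha i j).

HB.instance Definition _ := GRing.Zmodule.copy Y (tensor A B).

Definition Ymod_scale (r : AB) (y : Y) : Y := twist_mul (tauB t alpha i) r y.

Fact Ymod_scaleA r s y : Ymod_scale r (Ymod_scale s y) = Ymod_scale (r * s) y.
Proof. exact: esym (twist_act_assoc alpha charkp t_bnd i r s y). Qed.
Fact Ymod_scale1 : left_id 1 Ymod_scale.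
Proof. exact: (twist_act1 alpha charkp t_bnd i). Qed.
Fact Ymod_scaleDr : right_distributive Ymod_scale +%R.
Proof.
move=> r u v; have := twist_mul_linearr (tauB t alpha i) r 1 u v.
by rewrite !scale1r.
Qed.
Fact Ymod_scaleDl y : {morph Ymod_scale^~ y : r s / r + s}.
Proof.
move=> r s; have := twist_mul_linearl (tauB t alpha i) y 1 r s.
by rewrite !scale1r.
Qed.

HB.instance Definition _ := GRing.Zmodule_isLmodule.Build AB Y
  Ymod_scaleA Ymod_scale1 Ymod_scaleDr Ymod_scaleDl.

End Y.

Local Notation K := (trivmod charkp t_bnd alpha).

HB.instance Definition _ := GRing.Zmodule.copy K k.

Definition trivmod_scale (r : AB) (c : K) : K := eps r * (c : k).

Fact trivmod_scaleA r s c :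
  trivmod_scale r (trivmod_scale s c) = trivmod_scale (r * s) c.
Proof. by rewrite /trivmod_scale eps_twist_mul // mulrA. Qed.
Fact trivmod_scale1 : left_id 1 trivmod_scale.
Proof. by move=> c; rewrite /trivmod_scale eps1 // mul1r. Qed.
Fact trivmod_scaleDr : right_distributive trivmod_scale +%R.
Proof. by move=> r c c'; rewrite /trivmod_scale mulrDr. Qed.
Fact trivmod_scaleDl c : {morph trivmod_scale^~ c : r s / r + s}.
Proof. by move=> r s; rewrite /trivmod_scale /eps linearD mulrDl. Qed.

HB.instance Definition _ := GRing.Zmodule_isLmodule.Build AB K
  trivmod_scaleA trivmod_scale1 trivmod_scaleDr trivmod_scaleDl.

End Modules.

(* The bidegrees (i, j) with i + j = n. *)
Definition bideg (n : nat) : finType :=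
  {u : 'I_n.+1 * 'I_n.+1 | (u.1 + u.2 == n)%N}.

Definition bdi n (u : bideg n) : nat := (val u).1.
Definition bdj n (u : bideg n) : nat := (val u).2.

Definition bideg0 : bideg 0 :=
  exist (fun u : 'I_1 * 'I_1 => (u.1 + u.2 == 0)%N) (ord0, ord0) isT.

(* (i, j) |-> (i + 1, j) *)
Definition bdSi n (u : bideg n) : bideg n.+1 :=
  exist (fun u : 'I_n.+2 * 'I_n.+2 => (u.1 + u.2 == n.+1)%N)
    (lift ord0 (val u).1, widen_ord (leqnSn _) (val u).2) (valP u).

Fact bdSj_subproof n (u : bideg n) :
  (widen_ord (leqnSn n.+1) (val u).1 + lift ord0 (val u).2 == n.+1)%N.
Proof. by rewrite /= /bump /= addnCA add1n eqSS; apply: (valP u). Qed.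

(* (i, j) |-> (i, j + 1) *)
Definition bdSj n (u : bideg n) : bideg n.+1 :=
  exist (fun u : 'I_n.+2 * 'I_n.+2 => (u.1 + u.2 == n.+1)%N)
    (widen_ord (leqnSn _) (val u).1, lift ord0 (val u).2) (bdSj_subproof u).

Section Complex.
Variables (k : fieldType) (p : nat) (charkp : p \in [pchar k]).
Variables (t : nat) (t_bnd : (2 <= t <= p.-1)%N) (alpha : k).

Local Notation A := (trunc k p).
Local Notation B := (trunc k p).
Local Notation AB := (ttensor charkp t_bnd alpha).
Local Notation Y := (Ymod charkp t_bnd alpha).

(* d^h_{i+1,j}, multiplication by x1 or x1^(p-1) on the left factor *)
Definition dh (i j : nat) : Y i.+1 j -> Y i j :=
  tmap (fun a : A => tx k p ^+ (if odd i.+1 then 1%N else p.-1) * a)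
       (fun b : B => b).

(* d^v_{i,j+1}, multiplication by x2 or x2^(p-1) on the right factor, up to the
   sign (-1)^i *)
Definition dv (i j : nat) : Y i j.+1 -> Y i j :=
  tmap (fun a : A => (-1) ^+ i * a)
       (fun b : B => tx k p ^+ (if odd j.+1 then 1%N else p.-1) * b).

Definition Yn (n : nat) : lmodType AB :=
  dsum (fun u : bideg n => Y (bdi u) (bdj u) : lmodType AB).

(* d_{n+1} : Y_{n+1} -> Y_n. The (i,j) component of the image of y, for
   i + j = n, is the sum of the contributions of y_{i+1,j} and y_{i,j+1}. *)
Definition dn (n : nat) (y : Yn n.+1) : Yn n :=
  [ffun u : bideg n =>
     (@dh (bdi u) (bdj u) ((y : dsum _) (bdSi u))
      + @dv (bdi u) (bdj u) ((y : dsum _) (bdSj u)) : Y (bdi u) (bdj u))].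

(* eps_A (x) eps_B on Y_0 = Y_{0,0} *)
Definition eps0 (y : Yn 0) : trivmod charkp t_bnd alpha :=
  eps ((y : dsum _) bideg0).

End Complex.

(* Main.v *)
(** [Y_{i,j}] is free of rank one over [A (x)_tau B], generated by [1 (x) 1],
    which gives projectivity.  Exactness only concerns the underlying complex of
    vector spaces, the total complex of the tensor product of the periodic
    resolutions of [k] over [A] and over [B]. If [e] is the exponent of the
    differential arriving in degree [i], dividing by [x^e] and discarding the
    remainder is a [k]-linear contracting homotopy [s_i] of such a periodic
    resolution, and the total complex is contracted by [s (x) 1] together with
    [eps (x) s] on the column [i = 0]. *)
Require Import Defs.
From HB Require Import structures.
From mathcomp Require Import all_boot all_order all_algebra.

Set Implicit Arguments.
Unset Strict Implicit.
Unset Printing Implicit Defensive.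

Import GRing.Theory.
Local Open Scope ring_scope.

(** * Functoriality and additivity of tensor products of maps *)

Section TensorMaps.
Variable k : fieldType.
Implicit Types U V W : vectType k.

Lemma tens_linearl U V (v : V) : linear (fun u : U => tens u v).
Proof. exact: (tens_bilinear U V).1. Qed.

Lemma tens_linearr U V (u : U) : linear (fun v : V => tens u v).
Proof. exact: (tens_bilinear U V).2. Qed.

Lemma linear_at0 (M N : lmodType k) (f : M -> N) : linear f -> f 0 = 0.
Proof. by move/(_ (-1) 0 0); rewrite scaler0 addr0 scaleN1r addNr. Qed.

Lemma tens0l U V (v : V) : tens (0 : U) v = 0.
Proof. exact: linear_at0 (tens_linearl v). Qed.

Lemma tens0r U V (u : U) : tens u (0 : V) = 0.
Proof. exact: linear_at0 (tens_linearr u). Qed.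

Lemma tensZl U V (c : k) (u : U) (v : V) : tens (c *: u) v = c *: tens u v.
Proof. by rewrite -[c *: u]addr0 tens_linearl tens0l addr0. Qed.

Lemma tensZr U V (c : k) (u : U) (v : V) : tens u (c *: v) = c *: tens u v.
Proof. by rewrite -[c *: v]addr0 tens_linearr tens0r addr0. Qed.

Lemma tensDl U V (u u' : U) (v : V) : tens (u + u') v = tens u v + tens u' v.
Proof. by rewrite -[u]scale1r tens_linearl !scale1r. Qed.

Lemma tensDr U V (u : U) (v v' : V) : tens u (v + v') = tens u v + tens u v'.
Proof. by rewrite -[v]scale1r tens_linearr !scale1r. Qed.

Lemma tmap_tens_linear U V U' V' (f : U -> U') (g : V -> V') u v :
  linear f -> linear g -> tmap f g (tens u v) = tens (f u) (g v).
Proof.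
move=> lf lg; rewrite /tmap tlift_tens //.
by split=> [w c w1 w2|w c w1 w2]; rewrite (lf, lg) (tens_linearl, tens_linearr).
Qed.

Lemma tmap_comp U V U' V' U'' V''
    (f : {linear U -> U'}) (g : {linear V -> V'})
    (f' : {linear U' -> U''}) (g' : {linear V' -> V''}) w :
  tmap f' g' (tmap f g w) = tmap (f' \o f) (g' \o g) w.
Proof.
move: w; apply: tensor_ext => [c u v|c u v|u v]; rewrite ?linearP //.
by rewrite !tmap_tens.
Qed.

Lemma eq_tmap U V U' V' (f f' : U -> U') (g g' : V -> V') :
  f =1 f' -> g =1 g' -> tmap f g =1 tmap f' g'.
Proof.
move=> ff gg w; rewrite /tmap /tlift.
by apply: eq_bigr => i _; apply: eq_bigr => j _; rewrite ff gg.
Qed.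

Lemma tmap_id U V (w : tensor U V) : tmap idfun idfun w = w.
Proof. by rewrite {2}(tensor_sum w). Qed.

Lemma tmapDl U V U' V' (f f' : U -> U') (g : V -> V') w :
  tmap f g w + tmap f' g w = tmap (fun u => f u + f' u) g w.
Proof.
rewrite -[tmap f g w]scale1r; apply/esym/tlift_comb => u v.
by rewrite tensDl scale1r.
Qed.

Lemma tmapDr U V U' V' (f : U -> U') (g g' : V -> V') w :
  tmap f g w + tmap f g' w = tmap f (fun v => g v + g' v) w.
Proof.
rewrite -[tmap f g w]scale1r; apply/esym/tlift_comb => u v.
by rewrite tensDr scale1r.
Qed.

Lemma tmap0l U V U' V' (f : U -> U') (g : V -> V') w :
  (forall u, f u = 0) -> tmap f g w = 0.
Proof.
move=> f0; rewrite /tmap /tlift big1 // => i _; rewrite big1 // => j _.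
by rewrite f0 tens0l scaler0.
Qed.

Lemma tmap0r U V U' V' (f : U -> U') (g : V -> V') w :
  (forall v, g v = 0) -> tmap f g w = 0.
Proof.
move=> g0; rewrite /tmap /tlift big1 // => i _; rewrite big1 // => j _.
by rewrite g0 tens0r scaler0.
Qed.

End TensorMaps.

(** * Multiplication, division and constant term on truncated polynomials *)

Section Trunc.
Variables (k : fieldType) (p : nat).
Local Notation A := (trunc k p).
Local Notation x := (tx k p).

Definition xmul (e : nat) (a : A) : A := x ^+ e * a.
Definition xdrop (e : nat) (a : A) : A :=
  in_qpoly 'X^p (drop_poly e (a : {poly k})).
(** The augmentation followed by the unit of [A]: as an endomorphism it can be a factor in
    [tmap]. *)
Definition xaug (a : A) : A := taug a *: 1.

Fact xmul_linear e : linear (xmul e).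
Proof. by move=> c u v; rewrite /xmul mulrDr -scalerAr. Qed.
HB.instance Definition _ e :=
  GRing.isLinear.Build k A A _ (xmul e) (xmul_linear e).

Fact xdrop_linear e : linear (xdrop e).
Proof.
move=> c u v.
by rewrite /xdrop /= drop_polyD drop_polyZ linearP.
Qed.
HB.instance Definition _ e :=
  GRing.isLinear.Build k A A _ (xdrop e) (xdrop_linear e).

Lemma taugP (c : k) (u v : A) : taug (c *: u + v) = c * taug u + taug v.
Proof. by rewrite /taug /= hornerD hornerZ. Qed.

Fact xaug_linear : linear xaug.
Proof. by move=> c u v; rewrite /xaug taugP scalerDl scalerA. Qed.
HB.instance Definition _ :=
  GRing.isLinear.Build k A A _ xaug xaug_linear.

Hypothesis charkp : p \in [pchar k].

Let p_gt0 : (0 < p)%N. Proof. exact: prime_gt0 (pcharf_prime charkp). Qed.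

Let mkmonicXp : mk_monic 'X^p = 'X^p :> {poly k}.
Proof. by rewrite mk_monic_Xn prednK. Qed.

Lemma tx_expE s : x ^+ s = in_qpoly 'X^p 'X^s.
Proof. by rewrite /tx /qpolyX -rmorphXn. Qed.

Lemma tx_exp_ge s : (p <= s)%N -> x ^+ s = 0.
Proof.
move=> ps; rewrite -(subnK ps) exprD [x ^+ p]tx_expE.
suff -> : in_qpoly 'X^p ('X^p : {poly k}) = 0 by rewrite mulr0.
by apply: val_inj; rewrite /= mkmonicXp Pdiv.RingMonic.rmodpp ?monicXn.
Qed.

Lemma val_tx_exp s : (s < p)%N -> x ^+ s = 'X^s :> {poly k}.
Proof.
by move=> sp; rewrite tx_expE in_qpoly_small // mkmonicXp !size_polyXn.
Qed.

Lemma xmul_tx e s : xmul e (x ^+ s) = x ^+ (e + s).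
Proof. by rewrite /xmul exprD. Qed.

Lemma xdrop_tx e s : (s < p)%N ->
  xdrop e (x ^+ s) = if (e <= s)%N then x ^+ (s - e) else 0.
Proof.
move=> sp; rewrite /xdrop val_tx_exp //; case: leqP => es.
  rewrite tx_expE; congr in_qpoly; apply/polyP => i.
  by rewrite coef_drop_poly !coefXn -{1}(subnK es) eqn_add2r.
by rewrite drop_poly_eq0 ?linear0 // size_polyXn.
Qed.

Lemma xaug_tx s : xaug (x ^+ s) = (s == 0)%:R.
Proof. by rewrite /xaug taug_tx // scaler_nat. Qed.

Lemma xmul_xmul e e' : (p <= e + e')%N -> xmul e \o xmul e' =1 fun=> 0.
Proof.
by move=> ee a; rewrite /= /xmul mulrA -exprD tx_exp_ge ?mul0r.
Qed.

(** On [x ^+ s] exactly one summand survives: the first if [e' <= s], otherwise the second, since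
    then [e + s < p] and no truncation occurs. *)
Lemma xmul_xdrop e e' a : (e + e')%N = p ->
  xmul e' (xdrop e' a) + xdrop e (xmul e a) = a.
Proof.
move=> ee; move: a; apply: (@trunc_ext k p) => // [c u v|s sp].
  by rewrite !linearP /= scalerDr addrACA.
rewrite xmul_tx xdrop_tx //; case: leqP => es.
  rewrite (@tx_exp_ge (e + s)) ?linear0 ?addr0 ?xmul_tx ?subnKC //.
  by rewrite -ee leq_add2l.
rewrite linear0 add0r xdrop_tx ?leq_addr ?addKn //.
by rewrite -ee ltn_add2l.
Qed.

Lemma xmul_xdrop1 a : xmul 1 (xdrop 1 a) + xaug a = a.
Proof.
move: a; apply: (@trunc_ext k p) => // [c u v|[|s] sp].
- by rewrite !linearP /= scalerDr addrACA.
- by rewrite xdrop_tx //= linear0 add0r xaug_tx.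
by rewrite xdrop_tx // xmul_tx subnKC // xaug_tx addr0.
Qed.

Lemma xaug_xmul1 a : xaug (xmul 1 a) = 0.
Proof.
move: a; apply: (@trunc_ext k p) => // [c u v|c u v|s sp].
- by rewrite !linearP.
- by rewrite scaler0 addr0.
by rewrite xmul_tx xaug_tx.
Qed.

End Trunc.

(* The exponent of d^h_{i+1,j}, and of d^v_{j,i+1}. *)
Definition dexp (p i : nat) : nat := if odd i.+1 then 1%N else p.-1.

(** This sum makes consecutive differentials compose to zero and is the condition in
    [xmul_xdrop]. *)
Lemma dexpD p i : (0 < p)%N -> (dexp p i + dexp p i.+1)%N = p.
Proof.
by rewrite /dexp /=; case: (odd i) => /= /prednK => [<-|]; rewrite ?addn1.
Qed.

(** By rank-nullity, surjectivity forces a zero kernel. *)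
Lemma linear_surj_bij (k : fieldType) (V : vectType k) (f : {linear V -> V}) :
  (forall y, exists x, f x = y) -> bijective f.
Proof.
move=> surj; have kf : lker (linfun f) == 0%VS.
  have := limg_ker_dim (linfun f) fullv; rewrite capfv.
  have -> : limg (linfun f) = fullv.
    apply/eqP; rewrite eqEsubv subvf; apply/subvP => y _.
    by have [x <-] := surj y; rewrite -lfunE memv_img ?memvf.
  by rewrite -dimv_eq0 -[X in _ = X]add0n => /addIn ->.
exists (linfun f)^-1%VF => x; first by rewrite -{1}[f x]lfunE lker0_lfunK.
by rewrite -[LHS]lfunE lker0_lfunVK.
Qed.

(** * Compatibility of the twisted actions with the differentials, and freeness *)

Section TwistedAction.
Variables (k : fieldType) (p : nat) (charkp : p \in [pchar k]).
Variables (t : nat) (alpha : k).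
Local Notation A := (trunc k p).
Local Notation x := (tx k p).
Local Notation mon a b := (tens (x ^+ a : A) (x ^+ b : A)).
Local Notation X e := (@xmul k p e).
Local Notation act i := (twist_mul (tauB t alpha i)).

Lemma twist_mul_mon i a b c d : (b < p)%N ->
  act i (mon a b) (mon c d) =
  \sum_(j < b.+1) (('C(b, j) * rfact t (c + odd i) j)%:R * alpha ^+ j) *:
    mon (a + (c + j * t.-1)) (b - j + d).
Proof.
(* For [p <= c] both sides vanish: every exponent of the first variable on the right is at least
   [c]. *)
move=> bp; have [cp|pc] := ltnP c p; last first.
  rewrite (tx_exp_ge charkp pc) tens0l (linear_at0 (twist_mul_linearr _ _)).
  rewrite big1 // => j _; rewrite tx_exp_ge ?tens0l ?scaler0 //.
  by rewrite (leq_trans pc) // addnCA leq_addr.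
rewrite twist_mul_tens /= tauB_tens // linear_sum; apply: eq_bigr => j _.
rewrite linearZ /= tmap_tens_linear -?exprD // => e u v.
  by rewrite mulrDr -scalerAr.
by rewrite mulrDl -scalerAl.
Qed.

Lemma rfact_modp s s' j : s%:R = s'%:R :> k ->
  (rfact t s j)%:R = (rfact t s' j)%:R :> k.
Proof.
move=> ss; rewrite /rfact !natr_prod; apply: eq_bigr => l _.
by rewrite !natrD ss.
Qed.

(** The shift by [odd i] in the rising factorials absorbs the exponent: for [i] even both sides
    start at [c + 1], for [i] odd they start at [c] and [c + p], which agree in [k]. *)
Lemma twist_mul_xmull i r y :
  tmap (X (dexp p i)) idfun (act i.+1 r y) =
  act i r (tmap (X (dexp p i)) idfun y).
Proof.
move: r; apply: (mon_ext charkp) => [c u v|c u v|a b ap bp].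
- by rewrite twist_mul_linearl linearP.
- by rewrite twist_mul_linearl.
move: y; apply: (mon_ext charkp) => [e u v|e u v|c d cp dp].
- by rewrite twist_mul_linearr linearP.
- by rewrite linearP twist_mul_linearr.
rewrite tmap_tens /= xmul_tx !twist_mul_mon // linear_sum.
apply: eq_bigr => j _; rewrite linearZ /= tmap_tens /= xmul_tx.
rewrite !natrM; congr (_ * _ * _ *: _).
  have p0 : (0 < p)%N by apply: prime_gt0 (pcharf_prime charkp).
  apply: rfact_modp; rewrite /dexp /=.
  case: (odd i); rewrite /= ?addn0; last by rewrite addnC.
  by rewrite addn1 -addSn prednK // natrD (pcharf0 charkp) add0r.
by rewrite addnCA !addnA.
Qed.

(** The action affects the second factor only through multiplication, and [B] is commutative. *)
Lemma twist_mul_xmulr e i r y :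
  tmap idfun (X e) (act i r y) = act i r (tmap idfun (X e) y).
Proof.
move: r; apply: (mon_ext charkp) => [c u v|c u v|a b ap bp].
- by rewrite twist_mul_linearl linearP.
- by rewrite twist_mul_linearl.
move: y; apply: (mon_ext charkp) => [c u v|c u v|c d cp dp].
- by rewrite twist_mul_linearr linearP.
- by rewrite linearP twist_mul_linearr.
rewrite tmap_tens /= xmul_tx !twist_mul_mon // linear_sum.
apply: eq_bigr => j _; rewrite linearZ /= tmap_tens /= xmul_tx.
by rewrite [(e + _)%N]addnCA.
Qed.

Lemma mon_memv (U : {vspace tensor A A}) :
  (forall a b, (a < p)%N -> (b < p)%N -> mon a b \in U) -> forall w, w \in U.
Proof.
(* The identity and [projv U] are linear and agree on monomials. *)
move=> monU w; suff -> : w = projv U w by apply: memv_proj.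
move: w; apply: (mon_ext charkp) => // [c u v|a b ap bp]; first exact: linearP.
by rewrite projv_id ?monU.
Qed.

Definition twist_orbit i (r : tensor A A) : tensor A A :=
  act i r (tens (1 : A) (1 : A)).

Fact twist_orbit_linear i : linear (twist_orbit i).
Proof. exact: twist_mul_linearl. Qed.
HB.instance Definition _ i := GRing.isLinear.Build k (tensor A A) (tensor A A) _
  (twist_orbit i) (twist_orbit_linear i).

(* Triangularity: acting by [x1^a x2^b] on [1 (x) 1] gives the monomial
   [x1^a (x) x2^b] up to terms of lower degree in [x2]. *)
Lemma twist_orbit_bij i : bijective (twist_orbit i).
Proof.
apply: linear_surj_bij => y.
pose f : 'End(tensor A A) := linfun (twist_orbit i).
suff /memv_imgP[r _ ->] : y \in limg f by exists r; rewrite lfunE.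
(* The bound on [a] is dropped because the lower terms raise the exponent of [x1], possibly beyond
   [p - 1]. *)
apply: mon_memv y => a b _; elim/ltn_ind: b a => b IH a bp.
have : f (mon a b) \in limg f by rewrite memv_img ?memvf.
rewrite lfunE /= /twist_orbit -(expr0 x) twist_mul_mon // big_ord_recl /=.
rewrite bin0 /rfact big_ord0 expr0 mulr1 scale1r !addn0 subn0.
(* The term split off is the monomial itself; the remaining ones lie in the image by induction. *)
rewrite addrC rpredDl // rpred_sum // => j _; rewrite rpredZ // addn0 IH //.
  by rewrite /bump /= add1n subnS prednK ?leq_subr // subn_gt0.
by apply: leq_ltn_trans bp; rewrite leq_subr.
Qed.

End TwistedAction.

(** * Projectivity of free modules of rank one and of finite direct sums *)

Section Projective.
Variable R : nzRingType.

(** The module is free on [x], so a preimage [m] of [f x] determines the lift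
    [r *: x |-> r *: m]. *)
Lemma projective_cyclic (P : lmodType R) (x : P) :
  bijective (fun r : R => r *: x) -> projective P.
Proof.
move=> bij M N g f gsurj; have [m gm] := gsurj (f x).
have [phi _ phiK] := bij; have scaleI := bij_inj bij.
have hlin : linear (fun y => phi y *: m).
  move=> r y z; rewrite scalerA -scalerDl; congr (_ *: m); apply: scaleI.
  by rewrite scalerDl -scalerA !phiK.
pose h : {linear P -> M} :=
  HB.pack (fun y => phi y *: m) (GRing.isLinear.Build R P M _ _ hlin).
by exists h => y; rewrite /= linearZ /= gm -linearZ /= phiK.
Qed.

Variables (I : finType) (M : I -> lmodType R).

Lemma dsum_sumE (J : finType) (F : J -> dsum M) i :
  (\sum_j F j) i = \sum_j F j i.
Proof.
by apply: (big_morph (fun u : dsum M => u i)) => [u v|]; rewrite ffunE.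
Qed.

Definition dsum_inj i (u : M i) : dsum M :=
  [ffun j => dfwith (fun j => 0 : M j) u j].

Fact dsum_inj_linear i : linear (@dsum_inj i).
Proof.
move=> r u v; apply/ffunP => j; rewrite !ffunE.
have [->|ij] := eqVneq j i; first by rewrite !dfwith_in.
by rewrite !dfwith_out 1?eq_sym // scaler0 addr0.
Qed.
HB.instance Definition _ i := GRing.isLinear.Build R (M i) (dsum M) _
  (@dsum_inj i) (@dsum_inj_linear i).

Lemma dsum_injE (y : dsum M) : y = \sum_i dsum_inj (y i).
Proof.
apply/ffunP => j; rewrite dsum_sumE (bigD1 j) //= !ffunE dfwith_in.
by rewrite big1 ?addr0 // => i ij; rewrite !ffunE dfwith_out.
Qed.

(** Lifts chosen on the summands add up to a lift on the direct sum. *)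
Lemma projective_dsum : (forall i, projective (M i)) -> projective (dsum M).
Proof.
move=> projM M' N g f gsurj.
have /fin_all_exists[h hP] i : exists h : {linear M i -> M'},
    forall u, g (h u) = f (dsum_inj u).
  have [h hP] := projM i M' N g (f \o @dsum_inj i)%FUN gsurj.
  by exists h.
have hlin : linear (fun y : dsum M => \sum_i h i (y i)).
  move=> r u v; rewrite scaler_sumr -big_split; apply: eq_bigr => i _.
  by rewrite !ffunE linearP.
pose hL : {linear dsum M -> M'} :=
  HB.pack (fun y : dsum M => \sum_i h i (y i))
    (GRing.isLinear.Build R (dsum M) M' _ _ hlin).
exists hL => y; rewrite [in RHS](dsum_injE y) !linear_sum.
exact: eq_bigr.
Qed.

End Projective.

(** * Bidegrees of total degree [n], indexed by their first entry *)

Lemma bideg_exists n i : (i <= n)%N ->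
  exists2 u : bideg n, bdi u = i & bdj u = (n - i)%N.
Proof.
move=> le_in; have ni : (n - i < n.+1)%N by rewrite ltnS leq_subr.
have inP : ((Ordinal (n := n.+1) (m := i) le_in, Ordinal ni).1 +
            (Ordinal (n := n.+1) (m := i) le_in, Ordinal ni).2 == n)%N.
  by rewrite /= subnKC.
by exists (exist (fun u : 'I_n.+1 * 'I_n.+1 => (u.1 + u.2 == n)%N) _ inP).
Qed.

Lemma bdi_le n (u : bideg n) : (bdi u <= n)%N.
Proof. by rewrite -ltnS; apply: ltn_ord. Qed.

Lemma bdjE n (u : bideg n) : bdj u = (n - bdi u)%N.
Proof.
apply: (@addnI (bdi u)); rewrite subnKC ?bdi_le //; exact/eqP/(valP u).
Qed.

(** * The total complex in components, and its contraction *)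

Section Homotopy.
Variables (k : fieldType) (p : nat) (charkp : p \in [pchar k]).
Variables (t : nat) (t_bnd : (2 <= t <= p.-1)%N) (alpha : k).
Local Notation A := (trunc k p).
Local Notation AB := (ttensor charkp t_bnd alpha).
Local Notation Y := (Yn charkp t_bnd alpha).
Local Notation d := (@dn k p charkp t t_bnd alpha).
Local Notation T := (tensor A A).
Local Notation X e := (@xmul k p e).
Local Notation D e := (@xdrop k p e).
Local Notation E := (@xaug k p).
Local Notation H i := (tmap (X (dexp p i)) (@idfun A)).
Local Notation V j := (tmap (@idfun A) (X (dexp p j))).

(* All the Y_{i,j} have the same underlying space, so that an element of Y_n can
   be read as the sequence of its components indexed by i, with j = n - i. *)
Definition ycomp n (y : Y n) (i : nat) : T :=
  if insub (inord i : 'I_n.+1, inord (n - i) : 'I_n.+1) is Some u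
  then (y : dsum _) (u : bideg n) else 0.

Lemma ycompE n (y : Y n) (u : bideg n) : ycomp y (bdi u) = (y : dsum _) u.
Proof.
rewrite /ycomp -bdjE.
have -> : (inord (bdi u), inord (bdj u)) = val u.
  by rewrite /bdi /bdj !inord_val -surjective_pairing.
by rewrite valK.
Qed.

Lemma ycomp_ext n (y y' : Y n) :
  (forall i, (i <= n)%N -> ycomp y i = ycomp y' i) -> y = y'.
Proof.
by move=> yy; apply/ffunP => u; rewrite -!ycompE; apply/yy/bdi_le.
Qed.

Lemma ycomp0 n i : (i <= n)%N -> ycomp (0 : Y n) i = 0.
Proof. by case/bideg_exists=> u <- _; rewrite ycompE ffunE. Qed.

Lemma ycompP n (r : AB) (y y' : Y n) i : (i <= n)%N ->
  ycomp (r *: y + y') i =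
  twist_mul (tauB t alpha i) r (ycomp y i) + ycomp y' i.
Proof. by case/bideg_exists=> u <- _; rewrite !ycompE !ffunE. Qed.

Lemma dvE i j (w : Ymod charkp t_bnd alpha i j.+1) :
  dv w = (-1) ^+ i *: (V j w : T).
Proof.
(* A zero map is added to reach the shape of [tlift_comb], which pulls the sign out. *)
rewrite -[RHS]addr0 -[Z in _ + Z](@tmap0l k A A A A (fun=> 0) idfun w) //.
apply: tlift_comb => a b; rewrite tens0l addr0 -tensZl; congr (tens _ _).
by rewrite -signr_odd -[in RHS]signr_odd; case: odd;
   rewrite ?expr0 ?expr1 ?mulN1r ?scaleN1r ?mul1r ?scale1r.
Qed.

Lemma ycomp_dn n (y : Y n.+1) i : (i <= n)%N ->
  ycomp (d y) i =
  H i (ycomp y i.+1) + (-1) ^+ i *: V (n - i) (ycomp y i).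
Proof.
case/bideg_exists=> u <- <-; rewrite ycompE ffunE dvE.
by rewrite -(ycompE y (bdSi u)) -(ycompE y (bdSj u)).
Qed.

Lemma dn_linear n : linear (@dn k p charkp t t_bnd alpha n).
Proof.
move=> r y y'; apply: ycomp_ext => i le_in.
rewrite ycompP // !ycomp_dn // !ycompP ?(leqW le_in) // !raddfD /=.
(* The term scaled by the sign must come first for linearity to apply. *)
rewrite [Z in _ = twist_mul _ r Z + _]addrC twist_mul_linearr.
rewrite [Z in _ = Z + _]addrC.
by rewrite -twist_mul_xmull // -twist_mul_xmulr // addrACA.
Qed.

(** On column 0, division by [x1] contracts only up to [xaug] on the first factor; the component in
    bidegree [(0, n.+1)] contracts this remainder in the second variable. *)
Definition homotopy n (y : Y n) : Y n.+1 :=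
  [ffun u : bideg n.+1 =>
    if bdi u is i.+1 then tmap (D (dexp p i)) (@idfun A) (ycomp y i)
    else tmap E (D (dexp p n)) (ycomp y 0)].

Lemma ycomp_homotopy0 n (y : Y n) :
  ycomp (homotopy y) 0 = tmap E (D (dexp p n)) (ycomp y 0).
Proof.
have [u ui _] := @bideg_exists n.+1 0 isT.
by rewrite -ui ycompE ffunE ui.
Qed.

Lemma ycomp_homotopyS n (y : Y n) i : (i <= n)%N ->
  ycomp (homotopy y) i.+1 = tmap (D (dexp p i)) (@idfun A) (ycomp y i).
Proof.
move=> le_in; have [u ui _] := @bideg_exists n.+1 i.+1 le_in.
by rewrite -ui ycompE ffunE ui.
Qed.

Let p_gt0 : (0 < p)%N. Proof. exact: prime_gt0 (pcharf_prime charkp). Qed.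

Lemma xmull_xmull i w : H i (H i.+1 w) = 0.
Proof.
by rewrite tmap_comp tmap0l // => a; rewrite xmul_xmul ?dexpD.
Qed.

Lemma xmulr_xmulr j w : V j (V j.+1 w) = 0.
Proof.
by rewrite tmap_comp tmap0r // => a; rewrite xmul_xmul ?dexpD.
Qed.

(** The pure composites vanish; the two mixed ones coincide and carry the signs [(-1) ^+ i.+1] and
    [(-1) ^+ i]. *)
Lemma dn_dn n (y : Y n.+2) : d (d y) = 0.
Proof.
apply: ycomp_ext => i le_in.
rewrite ycomp0 // ycomp_dn // !ycomp_dn ?(leqW le_in) // !raddfD /=.
rewrite xmull_xmull add0r.
rewrite subSS subSn // !linearZ /= xmulr_xmulr !scaler0 addr0.
by rewrite !tmap_comp exprS mulN1r scaleNr addNr.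
Qed.

(** * Homotopy identities in each variable separately *)

Lemma xmull_htpy i w : H i.+1 (tmap (D (dexp p i.+1)) idfun w) +
  tmap (D (dexp p i)) idfun (H i w) = w.
Proof.
rewrite !tmap_comp tmapDl -[RHS]tmap_id; apply: eq_tmap => // a /=.
by rewrite xmul_xdrop ?dexpD.
Qed.

Lemma xmulr_htpy j w : V j.+1 (tmap E (D (dexp p j.+1)) w) +
  tmap E (D (dexp p j)) (V j w) = tmap E idfun w.
Proof.
rewrite !tmap_comp tmapDr; apply: eq_tmap => // a /=.
by rewrite xmul_xdrop ?dexpD.
Qed.

Lemma xmull_htpy0 w : H 0 (tmap (D (dexp p 0)) idfun w) + tmap E idfun w = w.
Proof.
rewrite !tmap_comp tmapDl -[RHS]tmap_id; apply: eq_tmap => // a /=.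
exact: xmul_xdrop1.
Qed.

Lemma xmulr_htpy0 w :
  V 0 (tmap E (D (dexp p 0)) w) + tmap E E w = tmap E idfun w.
Proof.
rewrite !tmap_comp tmapDr; apply: eq_tmap => // a /=.
exact: xmul_xdrop1.
Qed.

Lemma xaug_xmull0 e w : tmap E (D e) (H 0 w) = 0.
Proof.
by rewrite tmap_comp tmap0l // => a; rewrite /= xaug_xmul1.
Qed.

(** The components of [d y = 0], after the contractions are applied to them, supply the other half
    of each homotopy identity. *)
Lemma dn_homotopy n (y : Y n.+1) : d y = 0 -> d (homotopy y) = y.
Proof.
move=> dy0; apply: ycomp_ext => -[_|i le_in].
  (* On column 0 the augmentation kills the horizontal term, so the contracted vertical term is
     zero. *)
  have /(congr1 (tmap E (D (dexp p n)))) := ycomp_dn y (leq0n n).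
  rewrite dy0 ycomp0 // expr0 scale1r subn0 linear0 raddfD /= xaug_xmull0 add0r.
  move=> tv0; rewrite ycomp_dn // ycomp_homotopyS // ycomp_homotopy0 subn0.
  rewrite expr0 scale1r -[RHS]xmull_htpy0 -[Z in _ = _ + Z](xmulr_htpy n).
  by rewrite -tv0 addr0.
(* The contracted equation in column [i] turns the vertical term in column [i.+1] into the missing
   half of [xmull_htpy]. *)
have /(congr1 (tmap (D (dexp p i)) (@idfun A))) := ycomp_dn y le_in.
rewrite dy0 ycomp0 // linear0 raddfD /= linearZ /= => sv0.
rewrite ycomp_dn // !ycomp_homotopyS ?(ltnW le_in) // subSS.
rewrite -[RHS](xmull_htpy i); congr (_ + _).
move/eqP: sv0; rewrite eq_sym addr_eq0 => /eqP ->.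
by rewrite exprS mulN1r scaleNr !tmap_comp.
Qed.

(** * The augmentation and exactness in degree 0 *)

Lemma epsE w : tmap E E w = eps w *: tens (1 : A) (1 : A).
Proof.
move: w; apply: tensor_ext => [c u v|c u v|u v].
- exact: linearP.
- by rewrite eps_linear scalerDl scalerA.
by rewrite eps_tens tmap_tens /= tensZl tensZr scalerA.
Qed.

Lemma eps0E (y : Y 0) : eps0 y = eps (ycomp y 0).
Proof. by rewrite (ycompE y bideg0). Qed.

Lemma eps0_dn (y : Y 1) : eps0 (d y) = 0.
Proof.
(* Passing to [tmap E E] makes [tmap_comp] available; both differentials into degree 0 have exponent
   1 and die under [xaug]. *)
have epsEE w : eps w = eps (tmap E E w).
  rewrite epsE -[_ *: _]addr0 eps_linear eps1 // /eps linear0 addr0.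
  by rewrite [RHS]mulr1.
rewrite eps0E ycomp_dn // epsEE raddfD expr0 scale1r /= !tmap_comp.
rewrite [Z in Z + _]tmap0l => [|a]; last exact: xaug_xmul1.
rewrite add0r tmap0r => [|a]; last exact: xaug_xmul1.
by rewrite /eps linear0.
Qed.

Lemma eps0_linear : linear (@eps0 k p charkp t t_bnd alpha).
Proof.
move=> r y y'; rewrite !eps0E ycompP // -[twist_mul _ _ _]scale1r eps_linear.
by rewrite [Z in Z + _]mul1r eps_twist_mul.
Qed.

Lemma eps0_surj : surjective_fun (@eps0 k p charkp t t_bnd alpha).
Proof.
move=> c; exists [ffun=> c *: tens (1 : A) (1 : A)].
rewrite /eps0 ffunE -[_ *: _]addr0 eps_linear eps1 // /eps linear0 addr0.
exact: mulr1.
Qed.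

(** Here the identities in the two variables leave only the remainder [tmap E E], which is [eps]
    times the unit. *)
Lemma dn_homotopy0 (y : Y 0) : eps0 y = 0 -> d (homotopy y) = y.
Proof.
rewrite eps0E => ey0; apply: ycomp_ext => i; rewrite leqn0 => /eqP ->.
rewrite ycomp_dn // ycomp_homotopyS // ycomp_homotopy0 expr0 scale1r.
rewrite -[RHS]xmull_htpy0 -[Z in _ = _ + Z]xmulr_htpy0.
by rewrite epsE ey0 scale0r addr0.
Qed.

Lemma Ymod_projective i j :
  projective (Ymod charkp t_bnd alpha i j : lmodType AB).
Proof.
apply: (@projective_cyclic AB (Ymod charkp t_bnd alpha i j)
  (tens (1 : A) (1 : A))).
exact: twist_orbit_bij charkp _ _ _.
Qed.

End Homotopy.

Theorem mainTheorem3 (k : fieldType) (p : nat) (charkp : p \in [pchar k])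
    (alpha : k) (t : nat) (t_bnd : (2 <= t <= p.-1)%N) :
  @projective_resolution (ttensor charkp t_bnd alpha)
    (trivmod charkp t_bnd alpha) (Yn charkp t_bnd alpha)
    (@dn k p charkp t t_bnd alpha) (@eps0 k p charkp t t_bnd alpha).
Proof.
split; first by move=> n; apply: projective_dsum => u; apply: Ymod_projective.
- by split; [apply: dn_linear | apply: eps0_linear].
- exact: eps0_surj.
(* The preimage is [homotopy y], here and in higher degrees. *)
- move=> y; split=> [/dn_homotopy0 <-|[z <-]]; first by eexists.
  exact: eps0_dn.
move=> n y; split=> [/dn_homotopy <-|[z <-]]; first by eexists.
exact: dn_dn.
Qed.
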